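(* Let $p$ be a probability distribution over a countable alphabet $\mathcal{X}$, let $n\ge 1$, let $X^n$ be $n$ independent samples from $p$, and let $\alpha\in(0,1)$. Let $M_{max}(X^n)=\max_{u\in\mathcal{X}}\{p(u)\,\mathbf{1}(N_u(X^n)=0)\}$. Then $$P\left(M_{max}(X^n)\ \geq\ \min_{r\geq 1}\left(\frac{(q_{r,n}^* )^{r-1}(1-q_{r,n}^* )^n}{\alpha}\right)^{1/r}\right)\leq\alpha ,$$ where $q_{r,n}^*=\frac{r-1}{r-1+n}$ and the minimum is over real $r\ge 1$.
   Context: For a symbol $u\in\mathcal{X}$, $N_u(X^n)$ is the number of appearances of $u$ in the sample $X^n$, and $\mathbf{1}(\cdot)$ is the indicator function. Thus $M_{max}(X^n)$ is the largest probability among symbols that do not appear in the sample (and equals $0$ if there is no unobserved symbol of positive probability). The convention $0^0=1$ is used at $r=1$. *)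

(* Defs.v *)
From HB Require Import structures.
From mathcomp Require Import all_boot all_order all_algebra.
From mathcomp Require Import finmap.
From mathcomp Require Import all_classical all_reals all_analysis.

Set Implicit Arguments.
Unset Strict Implicit.
Unset Printing Implicit Defensive.
Import Order.TTheory GRing.Theory Num.Theory.
Import numFieldNormedType.Exports.

Local Open Scope classical_set_scope.
Local Open Scope ring_scope.

(* A [countType] may be finite; it carries the sigma-algebra of all subsets. *)
Definition is_distribution (R : realType) (X : countType) (p : X -> R) : Prop :=
  (forall u, 0 <= p u) /\ (\esum_(u in [set: X]) (p u)%:E = 1)%E.

Definition discrete_measurable_fun d (Omega : measurableType d) (X : countType)
    (Y : Omega -> X) : Prop :=
  forall A : set X, measurable (Y @^-1` A).

Definition mutually_independent d (Omega : measurableType d) (R : realType)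
    (P : probability Omega R) (X : countType) (n : nat)
    (Y : 'I_n -> Omega -> X) : Prop :=
  forall (J : {set 'I_n}) (A : 'I_n -> set X),
    (P (\bigcap_(i in [set` J]) (Y i @^-1` A i)) =
     \prod_(i in J) P (Y i @^-1` A i))%E.

Definition iid_sample d (Omega : measurableType d) (R : realType)
    (P : probability Omega R) (X : countType) (p : X -> R) (n : nat)
    (Y : 'I_n -> Omega -> X) : Prop :=
  [/\ forall i, discrete_measurable_fun (Y i),
      forall i u, P (Y i @^-1` [set u]) = (p u)%:E
    & mutually_independent P Y].

Definition occurrences (X : countType) (n : nat) (x : 'I_n -> X) (u : X) : nat :=
  #|[set i | x i == u]%SET|.

(* The supremum is a maximum when [p] is a distribution: see [Mmax_attained]. *)
Definition Mmax (R : realType) (X : countType) (p : X -> R) (n : nat)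
    (x : 'I_n -> X) : R :=
  sup (range (fun u : X => p u * (occurrences x u == 0%N)%:R)).

Definition qstar (R : realType) (n : nat) (r : R) : R :=
  (r - 1) / (r - 1 + n%:R).

(* [powR] satisfies [0 `^ 0 = 1], the convention used at [r = 1]. *)
Definition threshold (R : realType) (n : nat) (alpha r : R) : R :=
  ((qstar n r `^ (r - 1) * (1 - qstar n r) ^+ n) / alpha) `^ (r^-1).

Definition is_minimum (R : realType) (S : set R) (m : R) : Prop :=
  S m /\ lbound S m.

Lemma distribution_max (R : realType) (X : countType) (p v : X -> R) :
    is_distribution p -> (forall u, 0 <= v u <= p u) ->
  exists u, forall w, v w <= v u.
Proof.
move=> [p0 p1] vp.
have [[u vu]|/forallNP v0] := pselect (exists u, 0 < v u); last first.
  have [u|X0] := pselect (exists u : X, True).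
    case: u => u _; exists u => w.
    by apply: le_trans (andP (vp u)).1; rewrite leNgt; apply/negP/v0.
  exfalso; move: p1; rewrite esum1 => [/eqP|w]; last by case: X0; exists w.
  by rewrite eq_sym onee_eq0.
pose A := [set w | v u <= v w].
have Afin : finite_set A.
  apply: contrapT => Ainf.
  have [B BA cB] := infinite_set_fset (Num.Def.truncn (v u)^-1).+1 Ainf.
  have : ((\sum_(w <- B) (v u)%:E)%R <= 1)%E.
    rewrite -p1; apply: esum_ge; exists [set` B]; first by split.
    rewrite fsbig_finite//= set_fsetK.
    rewrite big_seq [leRHS]big_seq; apply: lee_sum => w wB; rewrite lee_fin.
    by apply: le_trans (andP (vp w)).2; apply: BA.
  rewrite sumEFin lee_fin big_const_seq count_predT iter_addr_0.
  apply/negP; rewrite -ltNge -mulr_natr -ltr_pdivrMl// mulr1.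
  by apply: (lt_le_trans (truncnS_gt _)); rewrite ler_nat.
have Au : u \in fset_set A by rewrite in_fset_set// inE /A/=.
pose m := [arg max_(w > [` Au]%fset) v (val w)]%O.
exists (val m) => w; rewrite /m; case: arg_maxP => //= i _ hi.
have [Aw|] := leP (v u) (v w).
  have wA : w \in fset_set A by rewrite in_fset_set// inE.
  exact: (hi [` wA]%fset).
by move=> /ltW/le_trans; apply; apply: (hi [` Au]%fset).
Qed.

Lemma Mmax_attained (R : realType) (X : countType) (p : X -> R) (n : nat)
    (x : 'I_n -> X) : is_distribution p ->
  let v u := p u * (occurrences x u == 0%N)%:R in
  exists2 u, Mmax p x = v u & forall w, v w <= v u.
Proof.
move=> pd v.
have [|u vu] := distribution_max (v := v) pd.
  by move=> u; rewrite /v; case: eqP => _; rewrite ?mulr1 ?mulr0 ?lexx pd.1.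
exists u => //; apply/eqP; rewrite eq_le; apply/andP; split.
  by apply: ge_sup => [|_ [w _ <-]]; [exists (v u), u|exact: vu].
by apply: ub_le_sup; [exists (v u) => _ [w _ <-]; exact: vu|exists u].
Qed.

(* Main.v *)
Require Import Defs.
From HB Require Import structures.
From mathcomp Require Import all_boot all_order all_algebra.
From mathcomp Require Import finmap ring lra.
From mathcomp Require Import all_classical all_reals all_analysis.
Import Order.TTheory GRing.Theory Num.Theory.
Import numFieldNormedType.Exports.
Local Open Scope classical_set_scope.
Local Open Scope ring_scope.

(** Write [f q r] for [(q^(r-1) (1-q)^n / alpha)^(1/r)].  For fixed [r] the
    product [q^(r-1) (1-q)^n] is largest at [q = qstar n r]
    ([qstar_maximizes]), so [threshold n alpha r] is the maximum of [f q r]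
    over [q] in [0, 1].

    Let [m] in (0, 1) be the root of [(1-m)^n = alpha m]
    ([exists_balance_point]).  Then [m^(r-1) (1-m)^n / alpha = m^r], that is
    [f m r = m] for every [r].  Hence no threshold is below [m], and the
    threshold equals [m] at the order [r] for which [qstar n r = m]: the
    minimum over [r] exists and is [m] ([balance_point_minimum]).

    It remains to bound the probability that an unseen symbol has mass at least
    [m].  By the union bound it is at most the sum of [(1-p u)^n] over the
    symbols with [p u >= m].  Each term is at most [(p u / m) (1-m)^n], and
    the [p u] sum to at most 1, so the total is at most
    [(1-m)^n / m = alpha] ([unseen_heavy_le]). *)

Lemma ln_le_tangent {R : realType} {a b : R} : 0 < a -> 0 < b ->
  ln a <= ln b + (a / b - 1).
Proof.
move=> a0 b0; have ab0 : 0 < a / b by rewrite divr_gt0.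
have := @le_ln1Dx _ (a / b - 1); rewrite subrKC ln_div ?posrE// => h.
by rewrite -lerBlDl; apply: h; lra.
Qed.

(** Replacing both logarithms by their tangents at [qstar] bounds the log of
    the left side by that of the right side plus a multiple of
    [q + (1 - q) - 1 = 0]. *)
Lemma qstar_maximizes {R : realType} {n : nat} {r q : R} :
  (0 < n)%N -> 1 <= r -> 0 < q < 1 ->
  q `^ (r - 1) * (1 - q) ^+ n
    <= qstar n r `^ (r - 1) * (1 - qstar n r) ^+ n.
Proof.
move=> n0 r1 /andP[q0 q1].
have q1' : 0 < 1 - q by rewrite subr_gt0.
have nR : 0 < n%:R :> R by rewrite ltr0n.
(* At [r = 1] the maximiser [qstar n r] is 0 and has no tangent for [ln]. *)
move: r1; rewrite le_eqVlt => /predU1P[<-|r1].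
  rewrite /qstar subrr mul0r subr0 expr1n !powRr0 !mul1r.
  by apply: exprn_ile1; [exact: ltW|lra].
have s0 : 0 < r - 1 by rewrite subr_gt0.
have sn0 : 0 < r - 1 + n%:R by rewrite addr_gt0.
have Q0 : 0 < qstar n r by rewrite divr_gt0.
have Q1E : 1 - qstar n r = n%:R / (r - 1 + n%:R).
  by rewrite /qstar; field; rewrite gt_eqF.
have Q1 : 0 < 1 - qstar n r by rewrite Q1E divr_gt0.
rewrite -ler_ln ?posrE ?mulr_gt0 ?powR_gt0 ?exprn_gt0//.
rewrite !lnM ?posrE ?powR_gt0 ?exprn_gt0// !ln_powR !lnXn//.
rewrite -![ln _ *+ n]mulr_natl.
have h1 := ler_wpM2l (ltW s0) (ln_le_tangent q0 Q0).
have h2 := ler_wpM2l (ltW nR) (ln_le_tangent q1' Q1).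
apply: (le_trans (lerD h1 h2)).
rewrite {2}Q1E {2}/qstar le_eqVlt; apply/orP; left; apply/eqP.
by field; rewrite !gt_eqF.
Qed.

Lemma exists_balance_point {R : realType} {n : nat} {alpha : R} :
  (0 < n)%N -> 0 < alpha ->
  exists2 m : R, 0 < m < 1 & (1 - m) ^+ n = alpha * m.
Proof.
move=> n0 a0.
pose f : {poly R} := alpha *: 'X - (1 - 'X) ^+ n.
have fE x : f.[x] = alpha * x - (1 - x) ^+ n by rewrite /f !hornerE.
have f0 : f.[0] = - 1 by rewrite fE subr0 expr1n mulr0 sub0r.
have f1 : f.[1] = alpha by rewrite fE subrr expr0n gtn_eqF// mulr1 subr0.
have [||m /andP[m0 m1] fm] := @poly_ivt _ f 0 1; first exact: ler01.
  by rewrite f0 f1 lerN10 ltW.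
have m_neq0 : m != 0.
  by apply: contraTneq fm => ->; rewrite rootE f0 oppr_eq0 oner_eq0.
have m_neq1 : m != 1 by apply: contraTneq fm => ->; rewrite rootE f1 gt_eqF.
exists m; first by rewrite !lt_neqAle eq_sym m_neq0 m0 m_neq1.
by move: fm; rewrite rootE fE subr_eq0 => /eqP.
Qed.

(** The equation for [m] turns the base of the [r]-th root into [m^r], so that
    [m] is a value of [f q r] common to all orders [r]. *)
Lemma balance_point_root {R : realType} {n : nat} {alpha m r : R} :
  0 < alpha -> 0 < m -> (1 - m) ^+ n = alpha * m -> 1 <= r ->
  ((m `^ (r - 1) * (1 - m) ^+ n) / alpha) `^ r^-1 = m.
Proof.
move=> a0 m0 mE r1; have r0 : 0 < r by exact: lt_le_trans r1.
rewrite mE mulrCA mulrAC mulfV ?mul1r ?gt_eqF//.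
rewrite mulrC mulr_powRB1 ?ltW// -powRrM mulfV ?gt_eqF//.
by rewrite powRr1 ?ltW.
Qed.

Lemma balance_point_minimum {R : realType} {n : nat} {alpha m : R} :
  (0 < n)%N -> 0 < alpha -> 0 < m < 1 -> (1 - m) ^+ n = alpha * m ->
  is_minimum [set threshold n alpha r | r in [set r : R | 1 <= r]] m.
Proof.
move=> n0 a0 m01 mE; have /andP[m0 m1] := m01.
have nR : 0 < n%:R :> R by rewrite ltr0n.
have m1' : 0 < 1 - m by rewrite subr_gt0.
split.
  (* Solving [(r - 1) / (r - 1 + n) = m] for [r]. *)
  pose r := 1 + n%:R * m / (1 - m).
  have r1 : 1 <= r by rewrite lerDl ltW// divr_gt0 ?mulr_gt0.
  exists r => //; rewrite /threshold.
  suff -> : qstar n r = m by exact: balance_point_root.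
  rewrite /qstar /r; field; rewrite !gt_eqF//=.
  by rewrite (_ : _ + _ = n%:R) //; ring.
move=> _ [r r1 <-] /=.
rewrite -[leLHS](balance_point_root a0 m0 mE r1).
have r0 : 0 <= r by rewrite (le_trans _ r1).
apply: ge0_ler_powR; rewrite ?invr_ge0// ?nnegrE.
- by rewrite divr_ge0 ?ltW// mulr_gt0 ?powR_gt0 ?exprn_gt0.
- apply: divr_ge0 (ltW a0); apply: le_trans (qstar_maximizes n0 r1 m01).
  by rewrite mulr_ge0 ?powR_ge0 ?exprn_ge0 ?ltW.
- by rewrite ler_wpM2r ?invr_ge0 ?(ltW a0) ?qstar_maximizes.
Qed.

Lemma distribution_fset_le1 {R : realType} {X : countType} {p : X -> R}
    (B : {fset X}) : is_distribution p -> \sum_(u <- B) p u <= 1.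
Proof.
move=> [p0 p1]; rewrite -lee_fin -sumEFin -p1.
apply: esum_ge; exists [set` B]; first by split.
by rewrite fsbig_finite//= set_fsetK.
Qed.

(** More than [1 / m] symbols of mass at least [m] would have total mass above
    1. *)
Lemma finite_heavy {R : realType} {X : countType} {p : X -> R} {m : R} :
  is_distribution p -> 0 < m -> finite_set [set u | m <= p u].
Proof.
move=> pd m0; apply: contrapT => Ainf.
have [B BA cB] := infinite_set_fset (Num.Def.truncn m^-1).+1 Ainf.
have : \sum_(w <- B) m <= 1.
  apply: le_trans (distribution_fset_le1 B pd).
  by rewrite big_seq [leRHS]big_seq; apply: ler_sum => w /BA.
rewrite big_const_seq count_predT iter_addr_0.
apply/negP; rewrite -ltNge -mulr_natr -ltr_pdivrMl// mulr1.
by apply: (lt_le_trans (truncnS_gt _)); rewrite ler_nat.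
Qed.

(** An intersection indexed by the full finite set has the shape that
    [mutually_independent] factors into a product. *)
Definition unseen {d} {Omega : measurableType d} {X : countType} {n : nat}
    (Xs : 'I_n -> Omega -> X) (u : X) : set Omega :=
  \bigcap_(i in [set` [set: 'I_n]%SET]) (Xs i @^-1` ~` [set u]).

Lemma unseenP {d} {Omega : measurableType d} {X : countType} {n : nat}
    (Xs : 'I_n -> Omega -> X) (u : X) (w : Omega) :
  unseen Xs u w <-> occurrences (fun i => Xs i w) u = 0%N.
Proof.
rewrite /occurrences; split=> [h|/eqP].
  apply/eqP; rewrite cards_eq0; apply/eqP/setP => i; rewrite !inE.
  by apply/negP => /eqP; apply: (h i); rewrite /= inE.
rewrite cards_eq0 => /eqP/setP h i _ /= E.
by have := h i; rewrite !inE E eqxx.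
Qed.

Lemma measurable_unseen {d} {Omega : measurableType d} {R : realType}
    {P : probability Omega R} {X : countType} {p : X -> R} {n : nat}
    (Xs : 'I_n -> Omega -> X) (u : X) :
  iid_sample P p Xs -> measurable (unseen Xs u).
Proof.
by move=> [mX _ _]; apply: fin_bigcap_measurable => // i _; exact: mX.
Qed.

Lemma prob_unseen {d} {Omega : measurableType d} {R : realType}
    {P : probability Omega R} {X : countType} {p : X -> R} {n : nat}
    (Xs : 'I_n -> Omega -> X) (u : X) :
  iid_sample P p Xs ->
  P (unseen Xs u) = ((1 - p u) ^+ n)%:E.
Proof.
move=> [mX pX iX]; rewrite /unseen iX.
rewrite (eq_bigr (fun=> (1 - p u)%:E)) => [|i _]; last first.
  by rewrite -preimage_setC probability_setC ?pX//; exact: mX.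
by rewrite prodEFin prodr_const cardsT card_ord.
Qed.

(** As [p u / m >= 1] on heavy symbols, inserting this factor in the union
    bound makes the sum of the masses appear. *)
Lemma unseen_heavy_le {d} {Omega : measurableType d} {R : realType}
    {P : probability Omega R} {X : countType} {p : X -> R} {n : nat}
    (Xs : 'I_n -> Omega -> X) {m : R} :
  is_distribution p -> iid_sample P p Xs -> 0 < m < 1 ->
  (P (\bigcup_(u in [set u | (m <= p u)%R]) unseen Xs u)
    <= ((1 - m) ^+ n / m)%:E)%E.
Proof.
move=> pd iid /andP[m0 m1].
have finA := finite_heavy pd m0.
have mU u : measurable (unseen Xs u) by exact: measurable_unseen iid.
have p_le1 u : p u <= 1.
  by have := distribution_fset_le1 [fset u]%fset pd; rewrite big_seq_fset1.
apply: le_trans.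
  by apply: (content_sub_fsum P finA) (subset_refl _) => //;
    exact: fin_bigcup_measurable.
rewrite fsbig_finite//=; under eq_bigr do rewrite (prob_unseen _ _ iid)//.
rewrite sumEFin lee_fin.
apply: (@le_trans _ _
  (\sum_(u <- fset_set [set u | m <= p u]) ((1 - m) ^+ n / m) * p u)).
  rewrite big_seq [leRHS]big_seq; apply: ler_sum => u.
  rewrite in_fset_set// inE/= => mu.
  rewrite -mulrA -[leLHS]mulr1 ler_pM ?exprn_ge0 ?subr_ge0//.
    by rewrite lerXn2r ?nnegrE ?subr_ge0 ?(ltW m1)// lerD2l lerN2.
  by rewrite mulrC ler_pdivlMr// mul1r.
rewrite -mulr_sumr ler_piMr ?distribution_fset_le1//.
by rewrite divr_ge0 ?exprn_ge0 ?subr_ge0 ?ltW.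
Qed.

(** Because the supremum [Mmax] is attained, reaching the level [m > 0] forces
    a single unseen symbol to reach it. *)
Lemma Mmax_ge_heavy {d} {Omega : measurableType d} {R : realType}
    {X : countType} {p : X -> R} {n : nat} (Xs : 'I_n -> Omega -> X) {m : R} :
  is_distribution p -> 0 < m ->
  [set w | m <= Mmax p (fun i => Xs i w)] =
  \bigcup_(u in [set u | m <= p u]) unseen Xs u.
Proof.
move=> pd m0; apply/seteqP; split=> w /=;
    have [u -> umax] := Mmax_attained (fun i => Xs i w) pd.
  case: eqP => [Nu|_]; last by rewrite mulr0 leNgt m0.
  by rewrite mulr1 => mu; exists u => //; exact/unseenP.
move=> [v /= mv /unseenP Nv]; apply: le_trans (umax v).
by rewrite Nv eqxx mulr1.
Qed.

Theorem theorem1 (R : realType) (X : countType) (p : X -> R)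
    (p_distr : is_distribution p)
    (n : nat) (n_ge1 : (1 <= n)%N)
    (d : measure_display) (Omega : measurableType d) (P : probability Omega R)
    (Xs : 'I_n -> Omega -> X) (Xs_iid : iid_sample P p Xs)
    (alpha : R) (alpha_gt0 : 0 < alpha) (alpha_lt1 : alpha < 1) :
  exists2 m : R,
    is_minimum [set threshold n alpha r | r in [set r : R | 1 <= r]] m &
    (P [set w | (Mmax p (fun i => Xs i w) >= m)%R] <= alpha%:E)%E.
Proof.
have [m m01 mE] := exists_balance_point n_ge1 alpha_gt0.
exists m; first exact: balance_point_minimum.
have /andP[m0 _] := m01; rewrite (Mmax_ge_heavy Xs p_distr m0).
have -> : alpha = (1 - m) ^+ n / m by rewrite mE mulfK ?gt_eqF.
exact: unseen_heavy_le.
Qed.
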